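(* There are no cyclic Beckett-Gray codes for $n = 3$ and none for $n = 4$.
   Context: A cyclic $n$-bit binary Gray code is a listing $(w_i)_{i\in\mathbb{Z}/2^n\mathbb{Z}}$ of all words in $\{0,1\}^n$, each occurring exactly once, such that $w_i$ and $w_{i+1}$ differ in exactly one bit position for every $i \in \mathbb{Z}/2^n\mathbb{Z}$ (indices modulo $2^n$). A cyclic Beckett-Gray code (for $n$) is a cyclic $n$-bit binary Gray code in which a $1$ in bit position $p$ is only permitted to change to a $0$ if, among all positions currently containing a $1$, position $p$ has contained its $1$ the longest. Precisely: for a word $w_i$ and a position $q$ at which $w_i$ has a $1$, let the current run length $r_i(q)$ be the largest $m\ge 1$ such that $w_i, w_{i-1}, \ldots, w_{i-m+1}$ all have a $1$ in position $q$ (this is finite and less than $2^n$ because the all-zero word occurs in the cyclic list). The condition is that whenever $w_i$ has a $1$ and $w_{i+1}$ has a $0$ in position $p$, then $r_i(p) > r_i(q)$ for every position $q \neq p$ at which $w_i$ has a $1$. Equivalently, starting the list at the all-zero word with an empty queue, the successive words (returning at the end to the all-zero word) are realized as the successive states of a first-in-first-out queue whose entries are the bit positions currently equal to $1$, each step being a single enqueue or a single dequeue. *)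

(* Defs.v *)
(* MathComp *)
From mathcomp Require Import all_boot.

Set Implicit Arguments.
Unset Strict Implicit.
Unset Printing Implicit Defensive.

(* Z/2^n is rendered as 'I_(2 ^ n) with the cyclic successor [ordS] and
   predecessor [ord_pred] ('Z_(2 ^ n) would be Z/2 for n = 0). *)
Definition cyclic_listing (n : nat) : Type := 'I_(2 ^ n) -> n.-tuple bool.

Definition cyclic_gray_code (n : nat) (w : cyclic_listing n) : Prop :=
  bijective w /\
  forall i : 'I_(2 ^ n),
    #|[set p : 'I_n | tnth (w i) p != tnth (w (ordS i)) p]| = 1.

(* w_i, w_(i-1), ..., w_(i-m+1) all have a 1 in position q. *)
Definition ones_back (n : nat) (w : cyclic_listing n)
    (i : 'I_(2 ^ n)) (q : 'I_n) (m : nat) : bool :=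
  [forall k : 'I_m, tnth (w (iter k (@ord_pred (2 ^ n)) i)) q].

(* The bound m < 2 ^ n loses nothing for a Gray code: the all-zero word occurs
   in the list, so every run of ones is shorter than 2 ^ n. *)
Definition run_length (n : nat) (w : cyclic_listing n)
    (i : 'I_(2 ^ n)) (q : 'I_n) : nat :=
  \max_(1 <= m < 2 ^ n | ones_back w i q m) m.

Definition cyclic_beckett_gray_code (n : nat) (w : cyclic_listing n) : Prop :=
  cyclic_gray_code w /\
  forall (i : 'I_(2 ^ n)) (p : 'I_n),
    tnth (w i) p -> ~~ tnth (w (ordS i)) p ->
    forall q : 'I_n, q != p -> tnth (w i) q ->
      run_length w i q < run_length w i p.

(* Main.v *)
(** Read from the all-zero word, the list is a run of a first-in-first-out
    queue: the positions carrying a 1, ordered by strictly decreasing run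
    length, change by one enqueue or by the removal of the head.  Hence a
    depth-first search over queue histories that never repeat a word must find
    a history returning to the empty queue after [2 ^ n] steps; for [n = 3]
    and [n = 4] the search fails. *)
Require Import Defs.
From mathcomp Require Import all_boot.

Set Implicit Arguments.
Unset Strict Implicit.
Unset Printing Implicit Defensive.

(** Queues of naturals and plain bit sequences carry no proofs, so the search can be evaluated. *)
Definition queue_word (n : nat) (Q : seq nat) : bitseq :=
  mkseq (fun p => p \in Q) n.

(** The head is the oldest entry. The spurious dequeue from an empty queue is harmless: the moves
    only have to include every legal step. *)
Definition queue_moves (n : nat) (Q : seq nat) : seq (seq nat) :=
  behead Q :: [seq rcons Q p | p <- iota 0 n & p \notin Q].

(* [V] lists the words already visited, [f] is the number of words still to be
   visited.  The explicit [if] keeps call-by-value evaluation from exploring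
   the pruned branches, which [&&] would not. *)
Fixpoint queue_search (n f : nat) (V : seq bitseq) (Q : seq nat) : bool :=
  if f is f'.+1 then
    has (fun Q' => if queue_word n Q' \in V then false
                   else queue_search n f' (queue_word n Q' :: V) Q')
        (queue_moves n Q)
  else [::] \in queue_moves n Q.

Lemma val_iter_ordS (N : nat) (i : 'I_N) (k : nat) :
  iter k (@ordS N) i = (i + k) %% N :> nat.
Proof.
elim: k => [|k IHk]; first by rewrite addn0 modn_small.
by rewrite /= IHk -addn1 modnDml addn1 addnS.
Qed.

Lemma iter_ordS_period (N : nat) (i : 'I_N) : iter N (@ordS N) i = i.
Proof. by apply: ord_inj; rewrite val_iter_ordS modnDr modn_small. Qed.

Lemma iter_ordS_inj (N : nat) (i : 'I_N) (s t : nat) :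
  s < N -> t < N -> iter s (@ordS N) i = iter t (@ordS N) i -> s = t.
Proof.
move=> sN tN /(congr1 (@nat_of_ord N)); rewrite !val_iter_ordS => /eqP.
by rewrite eqn_modDl !modn_small // => /eqP.
Qed.

Lemma ones_backS (n : nat) (w : cyclic_listing n) (i : 'I_(2 ^ n)) (q : 'I_n)
    (m : nat) :
  ones_back w (ordS i) q m.+1 = tnth (w (ordS i)) q && ones_back w i q m.
Proof.
apply/forallP/andP => [H|[H0 /forallP H] [[|k] lt_k_m] //].
  split; first exact: (H ord0).
  by apply/forallP => k; have := H (lift ord0 k); rewrite lift0 iterSr ordSK.
by rewrite [nat_of_ord _]/= iterSr ordSK; exact: (H (Ordinal (lt_k_m : k < m))).
Qed.

Section RunFromZero.

Variables (n : nat) (w : cyclic_listing n) (i0 : 'I_(2 ^ n)).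
Hypothesis w0 : forall q, tnth (w i0) q = false.

Let u (t : nat) := w (iter t (@ordS _) i0).

(** A run length by recursion on time instead of cyclic look-back. Stopping at time 0 cuts no run,
    because the word there is all zero. *)
Fixpoint ones_since_start (t : nat) (q : 'I_n) : nat :=
  if t is t'.+1 then
    if tnth (u t) q then (ones_since_start t' q).+1 else 0
  else 0.

Lemma ones_since_start_gt0 (t : nat) (q : 'I_n) :
  (0 < ones_since_start t q) = tnth (u t) q.
Proof. by case: t => [|t]; [rewrite /u /= w0 | rewrite /=; case: ifP]. Qed.

Lemma ones_since_start_le (t : nat) (q : 'I_n) : ones_since_start t q <= t.
Proof. by elim: t => //= t IHt; case: ifP. Qed.

Lemma ones_back_ones_since_start (t : nat) (q : 'I_n) (m : nat) :
  ones_back w (iter t (@ordS _) i0) q m = (m <= ones_since_start t q).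
Proof.
elim: t m => [|t IHt] [|m].
- by apply/forallP => -[].
- by apply/negbTE/forallP => /(_ ord0); rewrite /= w0.
- by apply/forallP => -[].
- by rewrite ones_backS IHt /= /u iterS; case: ifP.
Qed.

Lemma run_length_ones_since_start (t : nat) (q : 'I_n) :
  t < 2 ^ n ->
  run_length w (iter t (@ordS _) i0) q = ones_since_start t q.
Proof.
move=> lt_t; apply/eqP; rewrite eqn_leq /run_length; apply/andP; split.
  by apply/bigmax_leqP_seq => m _; rewrite ones_back_ones_since_start.
(* The maximum ranges over [1 <= m < 2 ^ n]: an empty run is treated apart, and a run of length at
   most [t] stays below the upper bound. *)
have [->//|r_gt0] := posnP (ones_since_start t q).
apply: leq_bigmax_seq; last by rewrite ones_back_ones_since_start.
rewrite mem_index_iota r_gt0 /=.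
exact: leq_ltn_trans (ones_since_start_le t q) lt_t.
Qed.

Definition fifo_state (t : nat) (Q : seq 'I_n) : Prop :=
  (forall p, (p \in Q) = tnth (u t) p) /\
  pairwise (fun p q => ones_since_start t q < ones_since_start t p) Q.

Lemma queue_word_fifo_state (t : nat) (Q : seq 'I_n) :
  fifo_state t Q -> queue_word n (map val Q) = u t.
Proof.
move=> [memQ _]; apply: (@eq_from_nth _ false); first by rewrite size_mkseq size_tuple.
move=> p; rewrite size_mkseq => lt_p; rewrite nth_mkseq //.
rewrite -[p]/(val (Ordinal lt_p)) (mem_map val_inj) memQ.
by rewrite (tnth_nth false).
Qed.

Hypothesis beckett_w : cyclic_beckett_gray_code w.

(** Exactly one bit flips. A bit going off has the longest run, hence is the head; a bit going on
    joins the tail with run 1. All surviving runs grow by one, so the order persists. *)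
Lemma fifo_state_step (t : nat) (Q : seq 'I_n) :
  t < 2 ^ n -> fifo_state t Q ->
  exists2 Q' : seq 'I_n,
    fifo_state t.+1 Q' & map val Q' \in queue_moves n (map val Q).
Proof.
move=> lt_t [memQ decrQ]; case: beckett_w => -[_ gray_w] fifo_w.
have /eqP/cards1P[p flip_p] := gray_w (iter t (@ordS _) i0).
have flip q : (tnth (u t) q != tnth (u t.+1) q) = (q == p).
  by have /setP/(_ q) := flip_p; rewrite !inE.
have runS q : tnth (u t.+1) q ->
    ones_since_start t.+1 q = (ones_since_start t q).+1.
  by move=> /= ->.
have same q : q != p -> tnth (u t.+1) q = tnth (u t) q.
  by rewrite -flip negbK => /eqP.
have flip_pp : tnth (u t.+1) p = ~~ tnth (u t) p.
  by have := flip p; rewrite eqxx; do 2!case: (tnth _ _).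
case up: (tnth (u t) p) flip_pp => flip_pp.
  have longest q : q != p -> q \in Q ->
      ones_since_start t q < ones_since_start t p.
    move=> qp; rewrite memQ => uq.
    rewrite -!run_length_ones_since_start //.
    by apply: fifo_w => //; move: flip_pp; rewrite /u iterS => ->.
  have : p \in Q by rewrite memQ.
  case: Q memQ decrQ longest => // x Q memQ /= /andP[/allP le_x decrQ] longest.
  rewrite inE => p_xQ.
  (* Were the head another position, [p] would stand behind it with a shorter run, against the
     Beckett condition. *)
  have xp : x = p.
    have [//|xp] := eqVneq x p.
    move: p_xQ; rewrite eq_sym (negbTE xp) => /le_x.
    by rewrite ltnNge ltnW // longest ?inE ?eqxx.
  subst x; have pQ : p \notin Q by apply/negP => /le_x; rewrite ltnn.
  have memQ' q : (q \in Q) = tnth (u t.+1) q.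
    have [->|qp] := eqVneq q p; first by rewrite flip_pp (negbTE pQ).
    by rewrite same // -memQ inE (negbTE qp).
  exists Q; last by rewrite inE eqxx.
  split=> //; move: decrQ; apply: sub_in_pairwise (allss Q).
  by move=> a b aQ bQ; rewrite !runS -?memQ'.
have pQ : p \notin Q by rewrite memQ up.
have memQ' q : (q \in rcons Q p) = tnth (u t.+1) q.
  rewrite mem_rcons inE; have [->|qp] := eqVneq q p; first by rewrite flip_pp.
  by rewrite same // -memQ.
have upS q : q \in Q -> tnth (u t.+1) q.
  by move=> qQ; rewrite -memQ' mem_rcons inE qQ orbT.
exists (rcons Q p).
  split=> //; rewrite pairwise_rcons; apply/andP; split.
    apply/allP => q qQ; rewrite !runS ?flip_pp ?upS // ltnS.
    (* Before the step [p] has count 0, every queued entry a positive one. *)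
    have /negbT := up; rewrite -ones_since_start_gt0 lt0n negbK => /eqP->.
    by rewrite ones_since_start_gt0 -memQ.
  move: decrQ; apply: sub_in_pairwise (allss Q).
  by move=> a b aQ bQ; rewrite !runS ?upS.
rewrite inE; apply/orP; right; rewrite map_rcons; apply/mapP.
exists (val p) => //.
by rewrite mem_filter (mem_map val_inj) pQ mem_iota ltn_ord.
Qed.

(** The code itself guides the search to success: the visited words all occur by time [t], so the
    next word is never pruned. *)
Lemma queue_search_fifo_state (f t : nat) (V : seq bitseq) (Q : seq 'I_n) :
  t + f.+1 = 2 ^ n -> fifo_state t Q ->
  (forall v, v \in V -> exists2 s, s <= t & v = u s) ->
  queue_search n f V (map val Q).
Proof.
elim: f t V Q => [|f IHf] t V Q tf stQ memV.
  have lt_t : t < 2 ^ n by rewrite -tf addn1.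
  have [Q' [memQ' _] moveQ'] := fifo_state_step lt_t stQ.
  (* Time [t.+1] is a full period, so the word is zero again. *)
  suff Q'0 : Q' = [::] by rewrite Q'0 in moveQ'.
  case: Q' {moveQ'} memQ' => // x Q' /(_ x).
  by rewrite inE eqxx -addn1 tf /u iter_ordS_period w0.
have lt_t1 : t.+1 < 2 ^ n by rewrite -tf !addnS !ltnS leq_addr.
have [Q' stQ' moveQ'] := fifo_state_step (ltnW lt_t1) stQ.
apply/hasP; exists (map val Q') => //.
rewrite (queue_word_fifo_state stQ'); case: ifP => [/memV[s le_s]|_].
  (* A repeated word would equate two distinct times below [2 ^ n]. *)
  move/val_inj; case: beckett_w => -[/bij_inj inj_w _] _ /inj_w eq_ts.
  have := iter_ordS_inj lt_t1 (leq_ltn_trans le_s (ltnW lt_t1)) eq_ts.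
  by move=> ts; rewrite -ts ltnn in le_s.
apply: (IHf t.+1) => //; first by rewrite addSnnS.
move=> v; rewrite inE => /predU1P[->|/memV[s le_s ->]]; first by exists t.+1.
by exists s => //; exact: leqW.
Qed.

End RunFromZero.

Lemma beckett_gray_code_queue_search (n : nat) (w : cyclic_listing n) :
  cyclic_beckett_gray_code w ->
  queue_search n (2 ^ n).-1 [:: queue_word n [::]] [::].
Proof.
move=> beckett_w; case: (beckett_w) => -[[g _ gK] _] _.
(* Surjectivity of the listing supplies the all-zero word as starting point. *)
pose i0 := g [tuple of nseq n false].
have w0 q : tnth (w i0) q = false.
  by rewrite gK (tnth_nth false) nth_nseq if_same.
have st0 : fifo_state w i0 0 [::] by split=> // p; rewrite w0.
apply: (queue_search_fifo_state w0 beckett_w (t := 0) (Q := [::])) => //.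
  by rewrite add0n prednK // expn_gt0.
by move=> v /[1!inE] /eqP->; exists 0; last exact: queue_word_fifo_state st0.
Qed.

Theorem mainTheorem4 :
  ~ (exists w : cyclic_listing 3, cyclic_beckett_gray_code w) /\
  ~ (exists w : cyclic_listing 4, cyclic_beckett_gray_code w).
Proof.
(* Both searches evaluate to [false]. *)
by split=> -[w /beckett_gray_code_queue_search]; vm_compute.
Qed.
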